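(* Let $\mathcal{C}=(\mathcal{C},\star,I,\diamond,J,\partial_l,\partial_r)$ be a linearly distributive category and let $G=(G,\delta,\epsilon)$ be a comonad on $\mathcal{C}$ which is a monoidal comonad with respect to $(\star,I)$, with structure maps $\phi_{A,B}:GA\star GB\to G(A\star B)$, $\phi_0:I\to GI$, and also a monoidal comonad with respect to $(\diamond,J)$, with structure maps $\psi_{A,B}:GA\diamond GB\to G(A\diamond B)$, $\psi_0:J\to GJ$. Suppose that for all $G$-coalgebras (with underlying objects) $A,B,C$ the following two equations hold: $$G(\partial_l)\circ\phi_{A,B\diamond C}\circ(1_{GA}\star\psi_{B,C})=\psi_{A\star B,C}\circ(\phi_{A,B}\diamond 1_{GC})\circ\partial_l$$ as morphisms $GA\star(GB\diamond GC)\to G((A\star B)\diamond C)$, and $$G(\partial_r)\circ\phi_{B\diamond C,A}\circ(\psi_{B,C}\star 1_{GA})=\psi_{B,C\star A}\circ(1_{GB}\diamond\phi_{C,A})\circ\partial_r$$ as morphisms $(GB\diamond GC)\star GA\to G(B\diamond(C\star A))$. Then the category $\mathcal{C}^G$ of Eilenberg–Moore coalgebras of $G$ is a linearly distributive category, with the two monoidal structures lifted from $\mathcal{C}$ along $\phi,\phi_0$ and $\psi,\psi_0$ and with linear distributions those of $\mathcal{C}$.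
   Context: Monoidal structures are taken to be strict for simplicity (this is not essential). A linearly distributive category is a category $\mathcal{C}$ with two monoidal structures $(\star,I)$ and $(\diamond,J)$ (no symmetry is assumed) and two natural transformations (linear distributions) $\partial_l:A\star(B\diamond C)\to(A\star B)\diamond C$ and $\partial_r:(B\diamond C)\star A\to B\diamond(C\star A)$, satisfying the Cockett–Seely coherence conditions. In the strict case these are the following. Unit conditions: $\partial_l$ is the identity when $A=I$ and when $C=J$; $\partial_r$ is the identity when $A=I$ and when $B=J$. Associativity conditions: the two evident composites of linear distributions agree in each of the cases (1) $A\star B\star(C\diamond D)\to(A\star B\star C)\diamond D$, i.e. $\partial_l^{A\star B,C,D}=\partial_l^{A,B\star C,D}\circ(1\star\partial_l^{B,C,D})$; (2) $A\star(B\diamond C\diamond D)\to(A\star B)\diamond C\diamond D$, i.e. $\partial_l^{A,B,C\diamond D}=(\partial_l^{A,B,C}\diamond1)\circ\partial_l^{A,B\diamond C,D}$; (3), (4) the two mirror-image conditions for $\partial_r$. Mixed conditions: (5) the two maps $A\star(B\diamond C)\star D\to(A\star B)\diamond(C\star D)$ given by $\partial_r\circ(\partial_l\star1)$ and $\partial_l\circ(1\star\partial_r)$ agree; (6) the two maps $(A\diamond B)\star(C\diamond D)\to A\diamond(B\star C)\diamond D$ given by $(\partial_r\diamond1)\circ\partial_l$ and $(1\diamond\partial_l)\circ\partial_r$ agree. A comonad $(G,\delta,\epsilon)$ is a monoidal comonad with respect to a monoidal structure if $G$ is a (lax) monoidal functor with the given structure maps and $\delta:G\to G^2$, $\epsilon:G\to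 1$ are monoidal natural transformations. For a comonad $G$ which is monoidal with respect to $(\star,I)$, the lifted monoidal structure on $\mathcal{C}^G$ is $(A,\gamma_A)\star(B,\gamma_B)=(A\star B,\ \phi_{A,B}\circ(\gamma_A\star\gamma_B))$ with unit $(I,\phi_0)$; similarly for $\diamond$, using $\psi,\psi_0$ and unit $(J,\psi_0)$. *)

(* Defs.v *)
From Stdlib Require Import ProofIrrelevance.

Set Implicit Arguments.
Unset Strict Implicit.
Unset Printing Implicit Defensive.

Record category := Category {
  ob :> Type;
  hom : ob -> ob -> Type;
  id : forall A, hom A A;
  comp : forall A B C, hom B C -> hom A B -> hom A C;
  comp_id_l : forall A B (f : hom A B), comp (id B) f = f;
  comp_id_r : forall A B (f : hom A B), comp f (id A) = f;
  comp_assoc : forall A B C D (h : hom C D) (g : hom B C) (f : hom A B),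
    comp h (comp g f) = comp (comp h g) f
}.

Arguments hom {c} A B.
Arguments id {c} A.
Arguments comp {c A B C} g f.

Notation "g ∘ f" := (comp g f) (at level 40, left associativity).

(** In a strict monoidal category one equates arrows such as [f ⋆ (g ⋆ h)] and
    [(f ⋆ g) ⋆ h], whose sources and targets are equal but not convertible.
    [heq f g] says that the sources of [f] and [g] are equal, that their targets
    are equal, and that [f] and [g] are the same arrow.  Under proof irrelevance
    it is ordinary equality when [f] and [g] lie in the same hom-set. *)
Inductive heq (C : category) (A B : C) (f : hom A B) :
    forall A' B' : C, hom A' B' -> Prop :=
  heq_refl : heq f f.

Notation "f ≅ g" := (heq f g) (at level 70, no associativity).

(** Only functoriality is imposed here; the monoidal laws are in [strict_monoidal]. *)
Record tensor (C : category) := Tensor {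
  tob : C -> C -> C;
  thom : forall A A' B B' : C, hom A A' -> hom B B' -> hom (tob A B) (tob A' B');
  tunit : C;
  thom_id : forall A B, thom (id A) (id B) = id (tob A B);
  thom_comp : forall A A' A'' B B' B'' (f' : hom A' A'') (f : hom A A')
      (g' : hom B' B'') (g : hom B B'),
    thom (f' ∘ f) (g' ∘ g) = thom f' g' ∘ thom f g
}.

Arguments tob {C} t A B.
Arguments thom {C} t {A A' B B'} f g.
Arguments tunit {C} t.

Notation "A ⊗[ T ] B" := (tob T A B)
  (at level 36, left associativity, format "A  ⊗[ T ]  B").
Notation "f ⊠[ T ] g" := (thom T f g)
  (at level 36, left associativity, format "f  ⊠[ T ]  g").

Record strict_monoidal (C : category) (T : tensor C) : Prop := StrictMonoidal {
  tob_assoc : forall A B D : C, A ⊗[T] (B ⊗[T] D) = (A ⊗[T] B) ⊗[T] D;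
  tob_unit_l : forall A : C, tunit T ⊗[T] A = A;
  tob_unit_r : forall A : C, A ⊗[T] tunit T = A;
  thom_assoc : forall (A A' B B' D D' : C)
      (f : hom A A') (g : hom B B') (h : hom D D'),
    f ⊠[T] (g ⊠[T] h) ≅ (f ⊠[T] g) ⊠[T] h;
  thom_unit_l : forall (A A' : C) (f : hom A A'), id (tunit T) ⊠[T] f ≅ f;
  thom_unit_r : forall (A A' : C) (f : hom A A'), f ⊠[T] id (tunit T) ≅ f
}.

(** [S] is the structure (⋆, I) and [P] is the structure (⋄, J). *)
Record linearly_distributive (C : category) (S P : tensor C) := LinearlyDistributive {
  ld_star : strict_monoidal S;
  ld_par : strict_monoidal P;
  dl : forall A B D : C, hom (A ⊗[S] (B ⊗[P] D)) ((A ⊗[S] B) ⊗[P] D);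
  dr : forall B D A : C, hom ((B ⊗[P] D) ⊗[S] A) (B ⊗[P] (D ⊗[S] A));
  dl_natural : forall (A A' B B' D D' : C)
      (f : hom A A') (g : hom B B') (h : hom D D'),
    dl A' B' D' ∘ (f ⊠[S] (g ⊠[P] h)) = ((f ⊠[S] g) ⊠[P] h) ∘ dl A B D;
  dr_natural : forall (B B' D D' A A' : C)
      (g : hom B B') (h : hom D D') (f : hom A A'),
    dr B' D' A' ∘ ((g ⊠[P] h) ⊠[S] f) = (g ⊠[P] (h ⊠[S] f)) ∘ dr B D A;
  dl_unit_star : forall B D : C, dl (tunit S) B D ≅ id (B ⊗[P] D);
  dl_unit_par : forall A B : C, dl A B (tunit P) ≅ id (A ⊗[S] B);
  dr_unit_star : forall B D : C, dr B D (tunit S) ≅ id (B ⊗[P] D);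
  dr_unit_par : forall D A : C, dr (tunit P) D A ≅ id (D ⊗[S] A);
  dl_assoc_star : forall A B D E : C,
    dl (A ⊗[S] B) D E ≅ dl A (B ⊗[S] D) E ∘ (id A ⊠[S] dl B D E);
  dl_assoc_par : forall A B D E : C,
    dl A B (D ⊗[P] E) ≅ (dl A B D ⊠[P] id E) ∘ dl A (B ⊗[P] D) E;
  dr_assoc_star : forall A B D E : C,
    dr A B (D ⊗[S] E) ≅ dr A (B ⊗[S] D) E ∘ (dr A B D ⊠[S] id E);
  dr_assoc_par : forall A B D E : C,
    dr (A ⊗[P] B) D E ≅ (id A ⊠[P] dr B D E) ∘ dr A (B ⊗[P] D) E;
  dl_dr_star : forall A B D E : C,
    dr (A ⊗[S] B) D E ∘ (dl A B D ⊠[S] id E)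
      ≅ dl A B (D ⊗[S] E) ∘ (id A ⊠[S] dr B D E);
  dl_dr_par : forall A B D E : C,
    (dr A B D ⊠[P] id E) ∘ dl (A ⊗[P] B) D E
      ≅ (id A ⊠[P] dl B D E) ∘ dr A B (D ⊗[P] E)
}.

Record endofunctor (C : category) := Endofunctor {
  fob :> C -> C;
  fmap : forall A B : C, hom A B -> hom (fob A) (fob B);
  fmap_id : forall A : C, fmap (id A) = id (fob A);
  fmap_comp : forall (A B D : C) (g : hom B D) (f : hom A B),
    fmap (g ∘ f) = fmap g ∘ fmap f
}.

Arguments fmap {C} e {A B} f.

Record comonad (C : category) := Comonad {
  cfun :> endofunctor C;
  delta : forall A : C, hom (cfun A) (cfun (cfun A));
  epsilon : forall A : C, hom (cfun A) A;
  delta_natural : forall (A B : C) (f : hom A B),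
    delta B ∘ fmap cfun f = fmap cfun (fmap cfun f) ∘ delta A;
  epsilon_natural : forall (A B : C) (f : hom A B),
    epsilon B ∘ fmap cfun f = f ∘ epsilon A;
  delta_coassoc : forall A : C,
    fmap cfun (delta A) ∘ delta A = delta (cfun A) ∘ delta A;
  delta_counit_l : forall A : C, epsilon (cfun A) ∘ delta A = id (cfun A);
  delta_counit_r : forall A : C, fmap cfun (epsilon A) ∘ delta A = id (cfun A)
}.

Arguments delta {C} c A.
Arguments epsilon {C} c A.

(** The last four laws say that [delta] and [epsilon] are monoidal natural
    transformations; the structure maps of the composite functor GG are
    [G phi ∘ phi] and [G phi0 ∘ phi0]. *)
Record monoidal_comonad (C : category) (T : tensor C) (G : comonad C) :=
    MonoidalComonad {
  mphi : forall A B : C, hom (G A ⊗[T] G B) (G (A ⊗[T] B));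
  mphi0 : hom (tunit T) (G (tunit T));
  mphi_natural : forall (A A' B B' : C) (f : hom A A') (g : hom B B'),
    mphi A' B' ∘ (fmap G f ⊠[T] fmap G g) = fmap G (f ⊠[T] g) ∘ mphi A B;
  mphi_assoc : forall A B D : C,
    mphi A (B ⊗[T] D) ∘ (id (G A) ⊠[T] mphi B D)
      ≅ mphi (A ⊗[T] B) D ∘ (mphi A B ⊠[T] id (G D));
  mphi_unit_l : forall A : C, mphi (tunit T) A ∘ (mphi0 ⊠[T] id (G A)) ≅ id (G A);
  mphi_unit_r : forall A : C, mphi A (tunit T) ∘ (id (G A) ⊠[T] mphi0) ≅ id (G A);
  delta_mphi : forall A B : C,
    delta G (A ⊗[T] B) ∘ mphi A B
      = fmap G (mphi A B) ∘ mphi (G A) (G B) ∘ (delta G A ⊠[T] delta G B);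
  delta_mphi0 : delta G (tunit T) ∘ mphi0 = fmap G mphi0 ∘ mphi0;
  epsilon_mphi : forall A B : C,
    epsilon G (A ⊗[T] B) ∘ mphi A B = epsilon G A ⊠[T] epsilon G B;
  epsilon_mphi0 : epsilon G (tunit T) ∘ mphi0 = id (tunit T)
}.

Arguments mphi {C T G} m A B.
Arguments mphi0 {C T G} m.

Record coalgebra (C : category) (G : comonad C) := Coalgebra {
  carrier :> C;
  coact : hom carrier (G carrier);
  coact_counit : epsilon G carrier ∘ coact = id carrier;
  coact_coassoc : fmap G coact ∘ coact = delta G carrier ∘ coact
}.

Arguments coact {C G} c.

Record coalgebra_hom (C : category) (G : comonad C) (A B : coalgebra G) :=
    CoalgebraHom {
  chom :> hom A B;
  chom_coact : fmap G chom ∘ coact A = coact B ∘ chom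
}.

Lemma coalgebra_hom_eq (C : category) (G : comonad C) (A B : coalgebra G)
  (f g : coalgebra_hom A B) : chom f = chom g -> f = g.
Proof.
destruct f as [f Hf], g as [g Hg]; simpl; intros E; subst g.
f_equal; apply proof_irrelevance.
Qed.

Definition coalgebra_id (C : category) (G : comonad C) (A : coalgebra G) :
  coalgebra_hom A A.
Proof.
exists (id A).
abstract (rewrite fmap_id, comp_id_l, comp_id_r; reflexivity).
Defined.

Definition coalgebra_comp (C : category) (G : comonad C) (A B D : coalgebra G)
  (g : coalgebra_hom B D) (f : coalgebra_hom A B) : coalgebra_hom A D.
Proof.
exists (chom g ∘ chom f).
abstract (rewrite fmap_comp, <- comp_assoc, chom_coact, comp_assoc, chom_coact;
          symmetry; apply comp_assoc).
Defined.

Definition EM (C : category) (G : comonad C) : category.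
Proof.
refine (@Category (coalgebra G) (@coalgebra_hom C G) (@coalgebra_id C G)
          (@coalgebra_comp C G) _ _ _);
abstract (intros; apply coalgebra_hom_eq;
          first [apply comp_id_l | apply comp_id_r | apply comp_assoc]).
Defined.

Section LiftedTensor.

Context (C : category) (T : tensor C) (G : comonad C) (M : monoidal_comonad T G).

Definition coalgebra_tensor (A B : coalgebra G) : coalgebra G.
Proof.
exists (A ⊗[T] B) (mphi M A B ∘ (coact A ⊠[T] coact B)).
- abstract (rewrite comp_assoc, epsilon_mphi, <- thom_comp, !coact_counit;
            apply thom_id).
- abstract (rewrite fmap_comp, comp_assoc, <- (comp_assoc (fmap G (mphi M A B))),
              <- mphi_natural, !comp_assoc, delta_mphi, <- !comp_assoc,
              <- !thom_comp, !coact_coassoc; reflexivity).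
Defined.

Definition coalgebra_tensor_hom (A A' B B' : coalgebra G)
  (f : coalgebra_hom A A') (g : coalgebra_hom B B') :
  coalgebra_hom (coalgebra_tensor A B) (coalgebra_tensor A' B').
Proof.
exists (chom f ⊠[T] chom g).
abstract (simpl; rewrite comp_assoc, <- mphi_natural, <- !comp_assoc,
            <- !thom_comp, !chom_coact; reflexivity).
Defined.

Definition coalgebra_unit : coalgebra G.
Proof.
exists (tunit T) (mphi0 M).
- exact (epsilon_mphi0 M).
- abstract (symmetry; apply delta_mphi0).
Defined.

Definition EM_tensor : tensor (EM G).
Proof.
refine (@Tensor (EM G) coalgebra_tensor coalgebra_tensor_hom coalgebra_unit _ _);
abstract (intros; apply coalgebra_hom_eq; first [apply thom_id | apply thom_comp]).
Defined.

End LiftedTensor.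

(* Main.v *)
From Stdlib Require Import ProofIrrelevance.
Require Import Defs.

(** The forgetful functor from [EM G] to [C] is faithful, and it preserves both
    lifted tensors and the candidate distributions on the nose; so every
    equation between coalgebra morphisms required of [EM G] is the equation
    that holds in [C].  Two points remain.

    First, the distributions of [C] at coalgebras must be coalgebra morphisms.
    Writing a, b, d for the coactions, naturality gives
    [(phi ⊠ 1) ∘ dl ∘ (a ⊠ (b ⊠ d)) = (phi ⊠ 1) ∘ ((a ⊠ b) ⊠ d) ∘ dl], and the
    hypothesis relating [phi] and [psi] turns the left-hand side, postcomposed
    with [psi], into the composite of the coaction of the source with
    [fmap G dl] ([dl_coact]); the case of [dr] is the mirror image
    ([dr_coact]).

    Second, the lifted tensors must be strictly associative and unital on
    objects.  By proof irrelevance a coalgebra is determined by its carrier and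
    its coaction ([coalgebra_eq]), so the carrier equations come from strictness
    in [C], and the coaction equations from the associativity and unit laws of
    the structure maps of [G] ([coalgebra_tensor_assoc] and its unit analogues).
    The same principle for morphisms is [coalgebra_hom_heq]. *)

(** * Heterogeneous equality of arrows *)

Section HeterogeneousEquality.

Set Implicit Arguments.
Unset Strict Implicit.

Context {C : category}.

Lemma heq_of_eq (A B : C) (f g : hom A B) : f = g -> f ≅ g.
Proof. intros <-; apply heq_refl. Qed.

Lemma heq_trans (A B A' B' A'' B'' : C)
  (f : hom A B) (g : hom A' B') (h : hom A'' B'') : f ≅ g -> g ≅ h -> f ≅ h.
Proof. intros [] H; exact H. Qed.

(** Transport along explicit equalities of the endpoints; once the endpoints are
    identified, proof irrelevance reduces these equalities to [eq_refl]. *)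
Lemma heq_transport (A B A' B' : C) (f : hom A B) (g : hom A' B') :
  f ≅ g -> exists (eA : A = A') (eB : B = B'),
    eq_rect B (hom A') (eq_rect A (fun X => hom X B) f A' eA) B' eB = g.
Proof. intros []; exists eq_refl, eq_refl; reflexivity. Qed.

Lemma eq_of_heq (A B : C) (f g : hom A B) : f ≅ g -> f = g.
Proof.
intros H; destruct (heq_transport H) as (eA & eB & E).
rewrite (proof_irrelevance _ eA eq_refl), (proof_irrelevance _ eB eq_refl) in E.
exact E.
Qed.

Lemma heq_comp (A B D A' B' D' : C) (g : hom B D) (f : hom A B)
  (g' : hom B' D') (f' : hom A' B') : g ≅ g' -> f ≅ f' -> g ∘ f ≅ g' ∘ f'.
Proof.
intros Hg Hf.
destruct (heq_transport Hg) as (eB & eD & _); destruct eB, eD.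
destruct (heq_transport Hf) as (eA & _ & _); destruct eA.
rewrite (eq_of_heq Hg), (eq_of_heq Hf); apply heq_refl.
Qed.

End HeterogeneousEquality.

(** * Equality of coalgebras and of their morphisms *)

Lemma coalgebra_eq (C : category) (G : comonad C) (A B : coalgebra G) :
  carrier A = carrier B -> coact A ≅ coact B -> A = B.
Proof.
destruct A as [A a a1 a2], B as [B b b1 b2]; simpl; intros E H.
destruct E; apply eq_of_heq in H; destruct H.
f_equal; apply proof_irrelevance.
Qed.

(** Equality of the underlying arrows in [C] does not identify the coactions on
    their endpoints, hence the two hypotheses on objects. *)
Lemma coalgebra_hom_heq (C : category) (G : comonad C) (A A' B B' : EM G)
  (f : hom A B) (f' : hom A' B') :
  A = A' -> B = B' -> chom f ≅ chom f' -> f ≅ f'.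
Proof.
intros eA eB H; destruct eA, eB.
apply heq_of_eq, coalgebra_hom_eq, eq_of_heq, H.
Qed.

(** * The lifted monoidal structure is strict *)

Section LiftedStrict.

Context {C : category} {T : tensor C} {G : comonad C} (M : monoidal_comonad T G).

Lemma thom_comp_l (A A' A'' B B' : C)
  (f' : hom A' A'') (f : hom A A') (g : hom B B') :
  (f' ∘ f) ⊠[T] g = (f' ⊠[T] id B') ∘ (f ⊠[T] g).
Proof. rewrite <- thom_comp, comp_id_l; reflexivity. Qed.

Lemma thom_comp_r (A A' B B' B'' : C)
  (f : hom A A') (g' : hom B' B'') (g : hom B B') :
  f ⊠[T] (g' ∘ g) = (id A' ⊠[T] g') ∘ (f ⊠[T] g).
Proof. rewrite <- thom_comp, comp_id_l; reflexivity. Qed.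

Context (HT : strict_monoidal T).

Lemma coalgebra_tensor_assoc (A B D : coalgebra G) :
  coalgebra_tensor M A (coalgebra_tensor M B D)
    = coalgebra_tensor M (coalgebra_tensor M A B) D.
Proof.
apply coalgebra_eq; simpl.
- apply (tob_assoc HT).
- rewrite thom_comp_l, thom_comp_r, !comp_assoc.
  apply heq_comp; [apply mphi_assoc | apply (thom_assoc HT)].
Qed.

Lemma coalgebra_tensor_unit_l (A : coalgebra G) :
  coalgebra_tensor M (coalgebra_unit M) A = A.
Proof.
apply coalgebra_eq; simpl.
- apply (tob_unit_l HT).
- apply (heq_trans (g := id (G A) ∘ coact A)).
  + replace (mphi0 M ⊠[T] coact A)
      with ((mphi0 M ⊠[T] id (G A)) ∘ (id (tunit T) ⊠[T] coact A))
      by (rewrite <- thom_comp, comp_id_l, comp_id_r; reflexivity).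
    rewrite comp_assoc.
    apply heq_comp; [apply mphi_unit_l | apply (thom_unit_l HT)].
  + apply heq_of_eq, comp_id_l.
Qed.

Lemma coalgebra_tensor_unit_r (A : coalgebra G) :
  coalgebra_tensor M A (coalgebra_unit M) = A.
Proof.
apply coalgebra_eq; simpl.
- apply (tob_unit_r HT).
- apply (heq_trans (g := id (G A) ∘ coact A)).
  + replace (coact A ⊠[T] mphi0 M)
      with ((id (G A) ⊠[T] mphi0 M) ∘ (coact A ⊠[T] id (tunit T)))
      by (rewrite <- thom_comp, comp_id_l, comp_id_r; reflexivity).
    rewrite comp_assoc.
    apply heq_comp; [apply mphi_unit_r | apply (thom_unit_r HT)].
  + apply heq_of_eq, comp_id_l.
Qed.

Lemma EM_strict_monoidal : strict_monoidal (EM_tensor M).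
Proof.
split.
- exact coalgebra_tensor_assoc.
- exact coalgebra_tensor_unit_l.
- exact coalgebra_tensor_unit_r.
- intros; apply coalgebra_hom_heq;
    [apply coalgebra_tensor_assoc .. | apply (thom_assoc HT)].
- intros; apply coalgebra_hom_heq;
    [apply coalgebra_tensor_unit_l .. | apply (thom_unit_l HT)].
- intros; apply coalgebra_hom_heq;
    [apply coalgebra_tensor_unit_r .. | apply (thom_unit_r HT)].
Qed.

End LiftedStrict.

(** * The linear distributions lift *)

Section LiftedDistributions.

Set Implicit Arguments.
Unset Strict Implicit.

Context {C : category} {S P : tensor C} (L : linearly_distributive S P)
  {G : comonad C} (phi : monoidal_comonad S G) (psi : monoidal_comonad P G).

Lemma dl_coact (A B D : coalgebra G) :
  fmap G (dl L A B D) ∘ mphi phi A (B ⊗[P] D) ∘ (id (G A) ⊠[S] mphi psi B D)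
    = mphi psi (A ⊗[S] B) D ∘ (mphi phi A B ⊠[P] id (G D))
        ∘ dl L (G A) (G B) (G D) ->
  fmap G (dl L A B D)
      ∘ coact (coalgebra_tensor phi A (coalgebra_tensor psi B D))
    = coact (coalgebra_tensor psi (coalgebra_tensor phi A B) D) ∘ dl L A B D.
Proof.
intros H; simpl.
rewrite thom_comp_l, thom_comp_r, !comp_assoc, H.
rewrite <- !comp_assoc, dl_natural; reflexivity.
Qed.

Lemma dr_coact (B D A : coalgebra G) :
  fmap G (dr L B D A) ∘ mphi phi (B ⊗[P] D) A ∘ (mphi psi B D ⊠[S] id (G A))
    = mphi psi B (D ⊗[S] A) ∘ (id (G B) ⊠[P] mphi phi D A)
        ∘ dr L (G B) (G D) (G A) ->
  fmap G (dr L B D A)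
      ∘ coact (coalgebra_tensor phi (coalgebra_tensor psi B D) A)
    = coact (coalgebra_tensor psi B (coalgebra_tensor phi D A)) ∘ dr L B D A.
Proof.
intros H; simpl.
rewrite thom_comp_l, thom_comp_r, !comp_assoc, H.
rewrite <- !comp_assoc, dr_natural; reflexivity.
Qed.

End LiftedDistributions.

Theorem proposition2p1 (C : category) (S P : tensor C)
  (L : linearly_distributive S P) (G : comonad C)
  (phi : monoidal_comonad S G) (psi : monoidal_comonad P G)
  (Hl : forall A B D : coalgebra G,
     fmap G (dl L A B D) ∘ mphi phi A (B ⊗[P] D) ∘ (id (G A) ⊠[S] mphi psi B D)
     = mphi psi (A ⊗[S] B) D ∘ (mphi phi A B ⊠[P] id (G D))
         ∘ dl L (G A) (G B) (G D))
  (Hr : forall A B D : coalgebra G,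
     fmap G (dr L B D A) ∘ mphi phi (B ⊗[P] D) A ∘ (mphi psi B D ⊠[S] id (G A))
     = mphi psi B (D ⊗[S] A) ∘ (id (G B) ⊠[P] mphi phi D A)
         ∘ dr L (G B) (G D) (G A)) :
  exists LG : linearly_distributive (EM_tensor phi) (EM_tensor psi),
    (forall A B D : coalgebra G, chom (dl LG A B D) = dl L A B D) /\
    (forall B D A : coalgebra G, chom (dr LG B D A) = dr L B D A).
Proof.
pose (dlG := fun A B D : coalgebra G =>
  CoalgebraHom (A := coalgebra_tensor phi A (coalgebra_tensor psi B D))
    (B := coalgebra_tensor psi (coalgebra_tensor phi A B) D)
    (dl_coact (Hl A B D))).
pose (drG := fun B D A : coalgebra G =>
  CoalgebraHom (A := coalgebra_tensor phi (coalgebra_tensor psi B D) A)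
    (B := coalgebra_tensor psi B (coalgebra_tensor phi D A))
    (dr_coact (Hr A B D))).
pose proof (EM_strict_monoidal phi (ld_star L)) as HS.
pose proof (EM_strict_monoidal psi (ld_par L)) as HP.
unshelve eexists (@LinearlyDistributive (EM G) (EM_tensor phi) (EM_tensor psi)
  HS HP dlG drG _ _ _ _ _ _ _ _ _ _ _ _); cycle -1.
{ split; intros; reflexivity. }
- intros; apply coalgebra_hom_eq, dl_natural.
- intros; apply coalgebra_hom_eq, dr_natural.
- intros; apply coalgebra_hom_heq; [| | apply dl_unit_star].
  + apply (tob_unit_l HS).
  + f_equal; apply (tob_unit_l HS).
- intros; apply coalgebra_hom_heq; [| | apply dl_unit_par].
  + f_equal; apply (tob_unit_r HP).
  + apply (tob_unit_r HP).
- intros; apply coalgebra_hom_heq; [| | apply dr_unit_star].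
  + apply (tob_unit_r HS).
  + f_equal; apply (tob_unit_r HS).
- intros; apply coalgebra_hom_heq; [| | apply dr_unit_par].
  + f_equal; apply (tob_unit_l HP).
  + apply (tob_unit_l HP).
- intros; apply coalgebra_hom_heq; [| | apply dl_assoc_star].
  + symmetry; apply (tob_assoc HS).
  + f_equal; symmetry; apply (tob_assoc HS).
- intros; apply coalgebra_hom_heq; [| | apply dl_assoc_par].
  + f_equal; apply (tob_assoc HP).
  + apply (tob_assoc HP).
- intros; apply coalgebra_hom_heq; [| | apply dr_assoc_star].
  + apply (tob_assoc HS).
  + f_equal; apply (tob_assoc HS).
- intros; apply coalgebra_hom_heq; [| | apply dr_assoc_par].
  + f_equal; symmetry; apply (tob_assoc HP).
  + symmetry; apply (tob_assoc HP).
- intros; apply coalgebra_hom_heq; [| | apply dl_dr_star].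
  + symmetry; apply (tob_assoc HS).
  + reflexivity.
- intros; apply coalgebra_hom_heq; [| | apply dl_dr_par].
  + reflexivity.
  + symmetry; apply (tob_assoc HP).
Qed.
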